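(* Let $M \ge 1$ and let $d_1, \dots, d_M$ be positive integers. For $0 \le k \le M$ put $\omega_k := \sum_{j=k+1}^M d_j$. Then, as formal power series in $a,b$, \[ \sigma_{d_1,\dots,d_M}(a,b) \,=\, \frac{\prod_{k=1}^M E_{d_k}\!\left(a^{\omega_k} b^{M-k+1}, a\right)}{\left(1 - a^{\omega_0} b^{M+1}\right) \prod_{k=1}^M \prod_{j=0}^{d_k} \left(1 - a^{\omega_k + d_k - j} b^{M-k+1}\right)} . \]
   Context: Given positive integers $d_1,\dots,d_M$, a multifold partition diamond for this sequence consists of nonnegative integers $\ell_0, \ell_1, \dots, \ell_M$ (the links) and, for each $k = 1,\dots,M$, nonnegative integers $f_{k,1}, \dots, f_{k,d_k}$ (the folds of the $k$-th diamond), satisfying \[ \ell_{k-1} \,\ge\, f_{k,i} \,\ge\, \ell_k \qquad \text{for all } 1 \le k \le M,\ 1 \le i \le d_k . \] (For $d_1 = \dots = d_M = d$ this is a $d$-fold partition diamond of length $M$.) Define \[ \sigma_{d_1,\dots,d_M}(a,b) \,:=\, \sum a^{\sum_{k=1}^M \sum_{i=1}^{d_k} f_{k,i}}\; b^{\sum_{k=0}^M \ell_k}, \] the sum over all multifold partition diamonds for the sequence $d_1,\dots,d_M$. For a permutation $\tau \in S_d$, let $\operatorname{Des}(\tau) := \{ j \in \{1,\dots,d-1\} : \tau(j) > \tau(j+1)\}$, $\operatorname{des}(\tau) := |\operatorname{Des}(\tau)|$, $\operatorname{maj}(\tau) := \sum_{j \in \operatorname{Des}(\tau)} j$, and let $E_d(x,y)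 := \sum_{\tau \in S_d} x^{\operatorname{des}(\tau)} y^{\operatorname{maj}(\tau)}$ be the Euler--Mahonian polynomial.
   Formalization: The formula as printed fails for (d_1,d_2)=(2,1) (coefficient of b: (1+a)^2 versus 1+a), so the left side is replaced by σ_{d_M,…,d_1}(a,b), the series of the reversed sequence, with the right side unchanged. *)

(* Defs.v *)
From HB Require Import structures.
From mathcomp Require Import all_boot all_order all_algebra perm.
From mathcomp Require Import finmap boolp classical_sets functions cardinality.

Set Implicit Arguments.
Unset Strict Implicit.
Unset Printing Implicit Defensive.

Import GRing.Theory.
Local Open Scope ring_scope.

(* Formal power series in one variable; series in a, b are [fps (fps int)],
   with [b] the outer variable. *)

Record fps (R : Type) := Fps { coefs : nat -> R }.

HB.instance Definition _ (R : Type) := gen_eqMixin (fps R).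
HB.instance Definition _ (R : Type) := gen_choiceMixin (fps R).

Lemma fpsP (R : Type) (p q : fps R) :
  (forall n, coefs p n = coefs q n) -> p = q.
Proof. by case: p q => [p] [q] /= /funext ->. Qed.

Section FpsZmodule.
Variable R : zmodType.
Implicit Types p q r : fps R.

Definition fps_zero : fps R := Fps (fun=> 0).
Definition fps_opp p : fps R := Fps (fun n => - coefs p n).
Definition fps_add p q : fps R := Fps (fun n => coefs p n + coefs q n).

Lemma fps_addA : associative fps_add.
Proof. by move=> p q r; apply: fpsP => n /=; rewrite addrA. Qed.
Lemma fps_addC : commutative fps_add.
Proof. by move=> p q; apply: fpsP => n /=; rewrite addrC. Qed.
Lemma fps_add0 : left_id fps_zero fps_add.
Proof. by move=> p; apply: fpsP => n /=; rewrite add0r. Qed.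
Lemma fps_addN : left_inverse fps_zero fps_opp fps_add.
Proof. by move=> p; apply: fpsP => n /=; rewrite addNr. Qed.

HB.instance Definition _ :=
  GRing.isZmodule.Build (fps R) fps_addA fps_addC fps_add0 fps_addN.

End FpsZmodule.

Section FpsRing.
Variable R : comNzRingType.
Implicit Types p q r : fps R.

Definition fpsC (c : R) : fps R := Fps (fun n => if n == 0%N then c else 0).
Definition fpsX : fps R := Fps (fun n => (n == 1%N)%:R).

Definition fps_mul p q : fps R :=
  Fps (fun n => \sum_(i < n.+1) coefs p i * coefs q (n - i)%N).

Definition fps_trunc n p : {poly R} := \poly_(i < n.+1) coefs p i.

Lemma coef_trunc n p i : (i <= n)%N -> (fps_trunc n p)`_i = coefs p i.
Proof. by move=> le_in; rewrite coef_poly ltnS le_in. Qed.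

Lemma coefs_mul n p q i : (i <= n)%N ->
  coefs (fps_mul p q) i = (fps_trunc n p * fps_trunc n q)`_i.
Proof.
move=> le_in; rewrite coefM; apply: eq_bigr => j _.
rewrite !coef_trunc //; first exact: leq_trans (leq_subr _ _) le_in.
by apply: leq_trans le_in; rewrite -ltnS.
Qed.

Lemma fps_mulC : commutative fps_mul.
Proof. by move=> p q; apply: fpsP => n; rewrite !(coefs_mul _ _ (leqnn n)) mulrC. Qed.

Lemma fps_mulA : associative fps_mul.
Proof.
move=> p q r; apply: fpsP => n.
transitivity ((fps_trunc n p * (fps_trunc n q * fps_trunc n r))`_n).
  rewrite coefM; apply: eq_bigr => i _.
  by rewrite coef_trunc -1?ltnS // (coefs_mul _ _ (leq_subr i n)).
rewrite mulrA coefM; apply: eq_bigr => i _.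
by rewrite (coefs_mul (n := n)) -1?ltnS // coef_trunc // leq_subr.
Qed.

Lemma fps_mul1 : left_id (fpsC 1) fps_mul.
Proof.
move=> p; apply: fpsP => n /=; rewrite big_ord_recl /= mul1r subn0.
by rewrite big1 ?addr0 // => i _; rewrite mul0r.
Qed.

Lemma fps_mulDl : left_distributive fps_mul +%R.
Proof.
move=> p q r; apply: fpsP => n /=; rewrite -big_split /=.
by apply: eq_bigr => i _; rewrite mulrDl.
Qed.

Lemma fps_1neq0 : fpsC 1 != 0.
Proof.
apply/eqP => /(congr1 (fun p => coefs p 0)) /= /eqP.
by rewrite oner_eq0.
Qed.

HB.instance Definition _ := GRing.Zmodule_isComNzRing.Build (fps R)
  fps_mulA fps_mulC fps_mul1 fps_mulDl fps_1neq0.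

Lemma coefs0M p q : coefs (p * q) 0 = coefs p 0 * coefs q 0.
Proof. exact: big_ord1. Qed.

End FpsRing.

Section FpsUnit.
Variable R : comUnitRingType.
Implicit Types p q : fps R.

Definition fps_unit : {pred fps R} := fun p => coefs p 0%N \is a GRing.unit.

(* The first [n] coefficients of the inverse of [p]. *)
Fixpoint fps_inv_seq p n : seq R :=
  if n isn't m.+1 then [::] else
  let s := fps_inv_seq p m in
  rcons s (if m == 0%N then (coefs p 0)^-1
           else - (coefs p 0)^-1 * \sum_(i < m) coefs p (m - i)%N * s`_i).

Definition fps_inv p : fps R :=
  if p \in fps_unit then Fps (fun n => (fps_inv_seq p n.+1)`_n) else p.

Lemma size_fps_inv_seq p n : size (fps_inv_seq p n) = n.
Proof. by elim: n => //= n IHn; rewrite size_rcons IHn. Qed.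

Lemma nth_fps_inv_seq p n i : (i < n)%N ->
  (fps_inv_seq p n)`_i = (fps_inv_seq p i.+1)`_i.
Proof.
elim: n => // n IHn; rewrite ltnS leq_eqVlt => /predU1P[-> //|lt_in].
by rewrite [LHS]/= nth_rcons size_fps_inv_seq lt_in IHn.
Qed.

Lemma fps_mulVx : {in fps_unit, left_inverse 1 fps_inv *%R}.
Proof.
move=> p Up; rewrite mulrC; apply: fpsP => n.
rewrite /fps_inv Up [LHS]/= (reindex_inj rev_ord_inj) /=.
have Up0 : coefs p 0 \is a GRing.unit by [].
rewrite big_ord_recr /= !subSS subnn subn0 nth_rcons size_fps_inv_seq ltnn eqxx.
case: n => [|n]; first by rewrite big_ord0 add0r divrr.
rewrite /= mulNr mulrN mulrA divrr // mul1r; apply/eqP; rewrite subr_eq0; apply/eqP.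
apply: eq_bigr => i _; rewrite subSS subKn; last exact: ltnW.
by congr (_ * _); apply/esym/(@nth_fps_inv_seq p n.+1).
Qed.

Lemma fps_unitPl p q : q * p = 1 -> p \in fps_unit.
Proof.
move=> /(congr1 (fun p => coefs p 0)); rewrite coefs0M /= => qp1.
by apply/unitrP; exists (coefs q 0); rewrite [_ * coefs q 0]mulrC.
Qed.

Lemma fps_invr_out : {in [predC fps_unit], fps_inv =1 id}.
Proof. by move=> p /negbTE Up; rewrite /fps_inv Up. Qed.

HB.instance Definition _ := GRing.ComNzRing_hasMulInverse.Build (fps R)
  fps_mulVx fps_unitPl fps_invr_out.

Lemma fps_unitE p : (p \is a GRing.unit) = (coefs p 0 \is a GRing.unit).
Proof. by []. Qed.

End FpsUnit.

Definition fps_a : fps (fps int) := fpsC (fpsX int).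
Definition fps_b : fps (fps int) := fpsX (fps int).

(* Positions are 0-based: [j : 'I_d] with [0 < j] stands for the descent
   tau(j) > tau(j+1) of the 1-based convention, so [j] is also its
   contribution to the major index. *)
Definition Des d (tau : 'S_d) : {set 'I_d} :=
  [set j : 'I_d | (0 < j)%N && (tau j < tau (ord_pred j))%N].

Definition des d (tau : 'S_d) : nat := #|Des tau|.

Definition maj d (tau : 'S_d) : nat := (\sum_(j in Des tau) j)%N.

Definition euler_mahonian (d : nat) (R : comNzRingType) (x y : R) : R :=
  \sum_(tau : 'S_d) x ^+ des tau * y ^+ maj tau.

Section Diamonds.
Variables (M : nat) (d : 'I_M -> nat).

(* [(l, f)] with links [l 0, ..., l M] and folds [f (k, i)]; the index [k : 'I_M]
   is the (k+1)-st diamond, lying between the links [k] and [k+1]. *)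
Definition links_folds : choiceType :=
  ({ffun 'I_M.+1 -> nat} * {ffun {k : 'I_M & 'I_(d k)} -> nat})%type.

Definition is_diamond (D : links_folds) : Prop :=
  forall (k : 'I_M) (i : 'I_(d k)),
    (D.1 (inord k.+1) <= D.2 (Tagged (fun k => 'I_(d k)) i) <= D.1 (inord k))%N.

Definition sum_links (D : links_folds) : nat := (\sum_k D.1 k)%N.

Definition sum_folds (D : links_folds) : nat :=
  (\sum_(k < M) \sum_(i < d k) D.2 (Tagged (fun k => 'I_(d k)) i))%N.

Definition diamonds (m n : nat) : set links_folds :=
  [set D | is_diamond D /\ sum_folds D = m /\ sum_links D = n]%classic.

(* [fset_set] is only meaningful on finite sets. *)
Lemma finite_diamonds m n : finite_set (diamonds m n).
Proof.
pose g (p : {ffun 'I_M.+1 -> 'I_n.+1} *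
            {ffun {k : 'I_M & 'I_(d k)} -> 'I_m.+1}) : links_folds :=
  ([ffun k => p.1 k : nat], [ffun k => p.2 k : nat]).
apply: (@sub_finite_set _ _ (g @` setT)%classic); last first.
  exact/finite_image/finite_finset.
move=> [l f] [_ [Em En]].
have l_le k : (l k <= n)%N by rewrite -En /sum_links (bigD1 k) //= leq_addr.
have f_le k : (f k <= m)%N.
  case: k => k i; rewrite -Em /sum_folds (bigD1 k) //= (bigD1 i) //=.
  by rewrite -addnA leq_addr.
exists ([ffun k => inord (l k)], [ffun k => inord (f k)]) => //.
by congr (_, _); apply/ffunP => k; rewrite !ffunE /= inordK ?ltnS.
Qed.

Definition sigma : fps (fps int) :=
  Fps (fun n => Fps (fun m => (#|` fset_set (diamonds m n)|)%:Z)).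

(* The diamonds are stacked from the largest link down, whereas [omega k] counts
   the folds of the diamonds of index greater than k.  The product formula with
   these exponents holds for the generating function of the reversed sequence
   [fun k => d (rev_ord k)], not for that of [d]: for d = (2, 1) the coefficient
   of b in [sigma d] is (1 + a)^2, while the formula gives 1 + a. *)
Definition omega (k : nat) : nat := (\sum_(j < M | (k <= j)%N) d j)%N.

Lemma denominator_unit :
  (1 - fps_a ^+ omega 0 * fps_b ^+ M.+1) *
  \prod_(k < M) \prod_(j < (d k).+1)
    (1 - fps_a ^+ (omega k.+1 + d k - j) * fps_b ^+ (M - k))
  \is a GRing.unit.
Proof.
have U (c : fps (fps int)) i : (0 < i)%N -> 1 - c * fps_b ^+ i \is a GRing.unit.
  case: i => // i _; rewrite exprS mulrCA fps_unitE.
  have -> : coefs (1 - fps_b * (c * fps_b ^+ i)) 0 =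
            1 - coefs (fps_b * (c * fps_b ^+ i)) 0 by [].
  by rewrite coefs0M /= mul0r subr0 unitr1.
rewrite unitrM U //=.
apply: (big_ind (fun x => x \is a GRing.unit)) => [|x y Ux Uy|k _]; first exact: unitr1.
  by rewrite unitrM Ux.
apply: (big_ind (fun x => x \is a GRing.unit)) => [|x y Ux Uy|j _]; first exact: unitr1.
  by rewrite unitrM Ux.
by apply: U; rewrite subn_gt0.
Qed.

End Diamonds.

(* Main.v *)
Require Import Defs.
From mathcomp Require Import all_boot all_order all_algebra perm.
From mathcomp Require Import finmap classical_sets cardinality.
From mathcomp Require Import zify.

(* Read from the smallest link upwards, the links of a diamond for the reversed
   sequence increase weakly, and the k-th diamond met has d_k folds.  Let n be
   the difference of its two links.  Raising a link raises all later links and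
   folds, and the folds of this diamond range freely over n + 1 values, so it
   contributes x_k^n [n+1]_a^(d_k) with x_k = a^(omega_k) b^(M-k+1).  Summing
   over n gives E_{d_k}(x_k, a) / prod_j (1 - x_k a^j), the MacMahon-Carlitz
   identity: each f : [d] -> [0, n] is sorted by exactly one permutation tau once
   ties are broken by increasing position; the sequence
   n >= f(tau 1) >= ... >= f(tau d) >= 0 is then strict at the descents of tau,
   and its successive differences are free apart from these strictness
   conditions, which produce x^des q^maj.  Infinite sums are avoided by computing
   modulo b^(N+1) for every N. *)

Set Implicit Arguments.
Unset Strict Implicit.
Unset Printing Implicit Defensive.

Import GRing.Theory.
Local Open Scope ring_scope.

(** * Power series modulo the power N + 1 of the variable *)

Section Truncation.
Variable R : comNzRingType.
Implicit Types (p q x : fps R) (N n : nat).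

Lemma eq_fps_trunc p q : (forall N, fps_trunc N p = fps_trunc N q) -> p = q.
Proof.
move=> pq; apply: fpsP => n.
have /(congr1 (fun u : {poly R} => u`_n)) := pq n.
by rewrite !coef_trunc.
Qed.

Lemma fps_truncP N p q :
  (forall n, (n <= N)%N -> coefs p n = coefs q n) <->
  fps_trunc N p = fps_trunc N q.
Proof.
split=> [pq|pq n le_nN].
  by apply/polyP => n; rewrite !coef_poly ltnS; case: leqP => // /pq.
by rewrite -!(coef_trunc _ le_nN) pq.
Qed.

Lemma fps_truncD N p q p' q' :
  fps_trunc N p = fps_trunc N p' -> fps_trunc N q = fps_trunc N q' ->
  fps_trunc N (p + q) = fps_trunc N (p' + q').
Proof.
move=> /fps_truncP pp' /fps_truncP qq'; apply/fps_truncP => n le_nN /=.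
by rewrite pp' ?qq'.
Qed.

Lemma fps_truncM N p q p' q' :
  fps_trunc N p = fps_trunc N p' -> fps_trunc N q = fps_trunc N q' ->
  fps_trunc N (p * q) = fps_trunc N (p' * q').
Proof.
move=> pp' qq'; apply/fps_truncP => n le_nN.
by rewrite [LHS](coefs_mul _ _ le_nN) pp' qq' -[LHS](coefs_mul _ _ le_nN).
Qed.

Lemma fps_trunc_sum N (I : finType) (P : pred I) (F G : I -> fps R) :
  (forall i, P i -> fps_trunc N (F i) = fps_trunc N (G i)) ->
  fps_trunc N (\sum_(i | P i) F i) = fps_trunc N (\sum_(i | P i) G i).
Proof.
move=> FG; apply: (big_ind2 (fun p q => fps_trunc N p = fps_trunc N q)) => //.
by move=> *; apply: fps_truncD.
Qed.

Lemma fps_trunc_prod N (I : finType) (P : pred I) (F G : I -> fps R) :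
  (forall i, P i -> fps_trunc N (F i) = fps_trunc N (G i)) ->
  fps_trunc N (\prod_(i | P i) F i) = fps_trunc N (\prod_(i | P i) G i).
Proof.
move=> FG; apply: (big_ind2 (fun p q => fps_trunc N p = fps_trunc N q)) => //.
by move=> *; apply: fps_truncM.
Qed.

(** When [x] has no constant term, each factor [x] raises the order by at least one. *)
Lemma coefs_exprM_lt x p i n :
  coefs x 0 = 0 -> (n < i)%N -> coefs (x ^+ i * p) n = 0.
Proof.
move=> x0; elim: i n => // i IHi n; rewrite ltnS exprS -mulrA => le_ni.
rewrite [LHS]big_ord_recl x0 mul0r add0r big1 // => j _.
rewrite IHi ?mulr0 //; apply: leq_trans le_ni.
by rewrite ltn_subrL /= (leq_ltn_trans _ (ltn_ord j)).
Qed.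

Lemma fps_trunc_exprM x p i N :
  coefs x 0 = 0 -> (N < i)%N -> fps_trunc N (x ^+ i * p) = fps_trunc N 0.
Proof.
move=> x0 lt_Ni; apply/fps_truncP => n le_nN.
by rewrite coefs_exprM_lt // (leq_ltn_trans le_nN).
Qed.

(** The product telescopes to x^e - x^(N+1), whose second term has order above N. When e > N the sum
    is empty and x^e itself vanishes. *)
Lemma fps_trunc_geometric x N e : coefs x 0 = 0 ->
  fps_trunc N ((\sum_(v < N.+1 | (e <= v)%N) x ^+ v) * (1 - x)) =
  fps_trunc N (x ^+ e).
Proof.
move=> x0; case: (ltnP N e) => [lt_Ne|le_eN].
  rewrite big_pred0 ?mul0r; last first.
    by move=> v; apply/negbTE; rewrite -ltnNge (leq_ltn_trans _ lt_Ne) // -ltnS.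
  by rewrite -[x ^+ e]mulr1 fps_trunc_exprM.
have -> : (\sum_(v < N.+1 | (e <= v)%N) x ^+ v) * (1 - x) =
          x ^+ e + x ^+ N.+1 * -1.
  have -> : \sum_(v < N.+1 | (e <= v)%N) x ^+ v =
            \sum_(e <= v < N.+1) x ^+ v.
    by rewrite big_geq_mkord.
  rewrite mulr_suml mulrN1 -(opprB (x ^+ N.+1)) -telescope_sumr ?(leqW le_eN) //.
  by rewrite -sumrN; apply: eq_bigr => v _; rewrite mulrBr mulr1 -exprSr opprB.
rewrite -[in RHS](addr0 (x ^+ e)).
by apply: fps_truncD => //; apply: fps_trunc_exprM.
Qed.

End Truncation.

(** * Bounded weakly decreasing sequences and their differences *)

(* [suffix_sums] maps the successive differences of a weakly decreasing
   sequence bounded by [N] back to the sequence. *)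
Section Chains.
Variables d N : nat.
Implicit Types l u : {ffun 'I_d.+1 -> 'I_N.+1}.

Definition chain l :=
  [forall k : 'I_d, (l (lift ord0 k) <= l (widen_ord (leqnSn d) k))%N].

Definition suffix_sums u : {ffun 'I_d.+1 -> 'I_N.+1} :=
  [ffun k : 'I_d.+1 => inord (\sum_(j < d.+1 | (k <= j)%N) u j)].

Definition differences l : {ffun 'I_d.+1 -> 'I_N.+1} :=
  [ffun k : 'I_d.+1 =>
     inord (l k - (if (k < d)%N then l (inord k.+1) : nat else 0%N))].

(** The bound on the total keeps every suffix sum in the range where [inord] is faithful. *)
Lemma suffix_sumsE u (k : 'I_d.+1) : (\sum_j u j <= N)%N ->
  suffix_sums u k = (\sum_(j < d.+1 | (k <= j)%N) u j)%N :> nat.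
Proof.
move=> le_uN; rewrite ffunE inordK // ltnS (leq_trans _ le_uN) //.
by rewrite [leqRHS](bigID (fun j : 'I_d.+1 => (k <= j)%N)) leq_addr.
Qed.

Lemma suffix_sum_rec (u : 'I_d.+1 -> nat) (k : 'I_d) :
  (\sum_(j < d.+1 | (widen_ord (leqnSn d) k <= j)%N) u j =
   u (widen_ord (leqnSn d) k) + \sum_(j < d.+1 | (lift ord0 k <= j)%N) u j)%N.
Proof.
rewrite (bigD1 (widen_ord (leqnSn d) k)) //=; congr (_ + _)%N.
by apply: eq_bigl => j; rewrite /= -val_eqE /= /bump; lia.
Qed.

Lemma suffix_sum_last (u : 'I_d.+1 -> nat) :
  (\sum_(j < d.+1 | ((ord_max : 'I_d.+1) <= j)%N) u j = u ord_max)%N.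
Proof.
rewrite (big_pred1 ord_max) // => j; rewrite /= -val_eqE /=.
by have := ltn_ord j; lia.
Qed.

(** Exchange of summations: u_j occurs in the suffix sum starting at k + 1 exactly when k < j. *)
Lemma sum_weighted_suffix_sums (w : 'I_d -> nat) (u : 'I_d.+1 -> nat) :
  (\sum_(k < d) w k * \sum_(j < d.+1 | (lift ord0 k <= j)%N) u j =
   \sum_(j < d.+1) (\sum_(k < d | (k < j)%N) w k) * u j)%N.
Proof.
under eq_bigr do rewrite big_distrr.
rewrite (exchange_big_dep xpredT) //=.
by apply: eq_bigr => j _; rewrite big_distrl.
Qed.

Lemma sum_suffix_sums (u : 'I_d.+1 -> nat) :
  (\sum_(k < d) \sum_(j < d.+1 | (lift ord0 k <= j)%N) u j =
   \sum_(j < d.+1) j * u j)%N.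
Proof.
transitivity (\sum_(k < d) 1 * \sum_(j < d.+1 | (lift ord0 k <= j)%N) u j)%N.
  by apply: eq_bigr => k _; rewrite mul1n.
rewrite (sum_weighted_suffix_sums (fun=> 1%N)).
apply: eq_bigr => j _; congr (_ * _)%N.
by rewrite -(big_ord_widen d (fun=> 1%N)) -1?ltnS // sum1_card card_ord.
Qed.

Lemma chain_suffix_sums u : (\sum_j u j <= N)%N -> chain (suffix_sums u).
Proof.
move=> uN; apply/forallP => k.
by rewrite !suffix_sumsE // suffix_sum_rec leq_addl.
Qed.

Lemma differencesE l (k : 'I_d) :
  differences l (widen_ord (leqnSn d) k) =
  (l (widen_ord (leqnSn d) k) - l (lift ord0 k))%N :> nat.
Proof.
rewrite ffunE /= ltn_ord inordK.
  by congr (_ - l _)%N; apply: val_inj; rewrite /= inordK ?ltnS.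
exact: leq_ltn_trans (leq_subr _ _) (ltn_ord _).
Qed.

Lemma suffix_sum_differences l (k : 'I_d.+1) : chain l ->
  (\sum_(j < d.+1 | (k <= j)%N) differences l j)%N = l k.
Proof.
(* Downward induction from the last entry, which is its own difference with 0. *)
move=> /forallP ch; have [n] := ubnP (d - k); elim: n k => // n IHn k.
rewrite ltnS => le_dk; case: (ltnP k d) => [lt_kd|le_d_k].
  have -> : k = widen_ord (leqnSn d) (Ordinal lt_kd) by apply: val_inj.
  rewrite suffix_sum_rec differencesE IHn ?subnK //.
  by move: le_dk; rewrite /= /bump /=; lia.
have -> : k = ord_max.
  by apply: val_inj => /=; apply/eqP; rewrite eqn_leq le_d_k -ltnS ltn_ord.
by rewrite suffix_sum_last ffunE /= ltnn subn0 inordK.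
Qed.

Lemma suffix_sumsK u : (\sum_j u j <= N)%N ->
  differences (suffix_sums u) = u.
Proof.
move=> uN; apply/ffunP => k; apply: val_inj.
case: (ltnP k d) => [lt_kd|le_d_k].
  have -> : k = widen_ord (leqnSn d) (Ordinal lt_kd) by apply: val_inj.
  by rewrite /= differencesE !suffix_sumsE // suffix_sum_rec addnK.
have -> : k = ord_max.
  by apply: val_inj => /=; apply/eqP; rewrite eqn_leq le_d_k -ltnS ltn_ord.
by rewrite ffunE /= ltnn subn0 inordK // suffix_sumsE // suffix_sum_last.
Qed.

Lemma differencesK l : chain l -> suffix_sums (differences l) = l.
Proof.
move=> ch; apply/ffunP => k; apply: val_inj.
by rewrite ffunE /= suffix_sum_differences // inordK.
Qed.

Lemma sum_differences l : chain l -> (\sum_j differences l j)%N = l ord0.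
Proof. by move=> ch; rewrite -(suffix_sum_differences ord0 ch). Qed.

(** The differences of a chain add up to its first entry, which is at most N by its type; so chains
    correspond to the [u] of total at most N. *)
Lemma big_chain (V : nmodType) (G : {ffun 'I_d.+1 -> 'I_N.+1} -> V) :
  \sum_(l | chain l) G l =
  \sum_(u : {ffun 'I_d.+1 -> 'I_N.+1} | (\sum_j u j <= N)%N) G (suffix_sums u).
Proof.
rewrite [RHS](reindex_onto differences suffix_sums) => [|u /suffix_sumsK //].
apply: eq_big => [l|l ch]; last by rewrite differencesK.
apply/idP/andP => [ch|[uN /eqP <-]]; last exact: chain_suffix_sums.
by rewrite differencesK // sum_differences // -ltnS.
Qed.

(** A weight that factors over the differences turns the sum over chains into a product of
    one-variable sums. Expanding that product also produces [u] of total above N, but these carry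
    [x] to a power above N and vanish. *)
Lemma fps_trunc_sum_chain (R : comNzRingType) (x : fps R)
    (t : 'I_d.+1 -> nat -> fps R) (G : {ffun 'I_d.+1 -> 'I_N.+1} -> fps R) :
  coefs x 0 = 0 ->
  (forall l u, (forall k : 'I_d.+1,
                  l k = (\sum_(j < d.+1 | (k <= j)%N) u j)%N :> nat) ->
     G l = \prod_j (x ^+ u j * t j (u j))) ->
  fps_trunc N (\sum_(l | chain l) G l) =
  fps_trunc N (\prod_j \sum_(v < N.+1) x ^+ v * t j v).
Proof.
move=> x0 GE; rewrite big_chain bigA_distr_bigA /=.
rewrite [in RHS](bigID (fun u : {ffun 'I_d.+1 -> 'I_N.+1} =>
  (\sum_j u j <= N)%N)) -[in LHS](addr0 (\sum_(u | _) _)) /=.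
apply: fps_truncD; first apply: fps_trunc_sum => u uN.
  by rewrite (GE _ u) // => k; rewrite suffix_sumsE.
apply: esym; transitivity (fps_trunc N
  (\sum_(u : {ffun 'I_d.+1 -> 'I_N.+1} | ~~ (\sum_j u j <= N)%N) (0 : fps R))).
  apply: fps_trunc_sum => u; rewrite -ltnNge => Nu.
  by rewrite big_split /= -expr_sum fps_trunc_exprM.
by rewrite big1.
Qed.

End Chains.

(** * Sorting a function by a unique permutation *)

Section SortingPermutation.
Variables d N : nat.
Implicit Types (f : {ffun 'I_d -> 'I_N.+1}) (tau : 'S_d).

(* Decreasing values of [f], ties broken by increasing index. *)
Definition precedes f : rel 'I_d :=
  fun i j => (f j + (j < i) <= f i)%N.

Definition sorted_by tau f :=
  [forall j : 'I_d, (0 < j)%N ==> precedes f (tau (ord_pred j)) (tau j)].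

Lemma precedes_total f : total (precedes f).
Proof. by move=> i j; rewrite /precedes; lia. Qed.

Lemma precedes_trans f : transitive (precedes f).
Proof. by move=> j i k; rewrite /precedes; lia. Qed.

Lemma precedes_anti f : antisymmetric (precedes f).
Proof. by move=> i j; rewrite /precedes => ij; apply: val_inj => /=; lia. Qed.

Lemma sorted_byE tau f : sorted_by tau f = sorted (precedes f) (codom tau).
Proof.
have [d0|d_gt0] := posnP d.
  have -> : codom tau = [::] by apply: size0nil; rewrite size_codom card_ord.
  by apply/forallP => i; have := ltn_ord i; rewrite [X in (_ < X)%N]d0.
pose i0 := Ordinal d_gt0; have nthE (i : 'I_d) : nth i0 (codom tau) i = tau i.
  by rewrite (nth_map i0) ?size_enum_ord // nth_ord_enum.
apply/forallP/(sortedP i0) => [sf i|sf j].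
  rewrite size_codom card_ord => lt_i1.
  have := sf (Ordinal lt_i1); rewrite -!nthE /=.
  (* [ord_pred] is cyclic, but does not wrap around at the positive position i + 1. *)
  by rewrite modnDr modn_small // ltnW.
apply/implyP => j_gt0; rewrite -!nthE.
have := sf j.-1; rewrite size_codom card_ord prednK // ltn_ord => /(_ isT).
rewrite /= -[X in (X + d)%N](prednK j_gt0) addSn /= modnDr modn_small //.
by rewrite (leq_ltn_trans (leq_pred _)).
Qed.

(** With ties broken, [precedes f] is a total order, so [enum 'I_d] has a single sorted
    rearrangement, and [codom tau] is always a rearrangement of it. *)
Lemma sorting_perm f : {tau0 | forall tau, sorted_by tau f = (tau == tau0)}.
Proof.
pose s := sort (precedes f) (enum 'I_d).
have size_s : size s == d by rewrite size_sort size_enum_ord.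
have inj_s : injective (tnth (Tuple size_s)).
  by apply/tuple_uniqP; rewrite sort_uniq enum_uniq.
exists (perm inj_s) => tau.
have codom_s : codom (perm inj_s) = s.
  rewrite -[RHS](map_tnth_enum (Tuple size_s)).
  by apply: eq_map => i; rewrite permE.
rewrite sorted_byE; apply/idP/eqP => [st|->]; last first.
  by rewrite codom_s; apply/sort_sorted/precedes_total.
have : codom tau = codom (perm inj_s).
  rewrite codom_s; apply: sorted_eq st _ _ => //.
  - exact: precedes_trans.
  - exact: precedes_anti.
  - exact/sort_sorted/precedes_total.
  apply: uniq_perm => [||i].
  - by rewrite map_inj_uniq ?enum_uniq //; apply: perm_inj.
  - by rewrite sort_uniq enum_uniq.
  by rewrite mem_sort mem_enum -(permKV tau i) codom_f.
by move=> /eq_in_map eq_tau; apply/permP => i; rewrite eq_tau ?mem_enum.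
Qed.

(** Each [f] is counted once, under the permutation that sorts it. *)
Lemma sum_sorted_by (V : nmodType) (P : pred {ffun 'I_d -> 'I_N.+1})
    (F : {ffun 'I_d -> 'I_N.+1} -> V) :
  \sum_(f | P f) F f = \sum_(tau : 'S_d) \sum_(f | P f && sorted_by tau f) F f.
Proof.
under [RHS]eq_bigr do rewrite big_mkcondr.
rewrite exchange_big; apply: eq_bigr => f _; have [tau0 tauE] := sorting_perm f.
by under eq_bigr do rewrite tauE; rewrite -big_mkcond big_pred1_eq.
Qed.

End SortingPermutation.

(** * The MacMahon-Carlitz identity *)

Section MacMahonCarlitz.
Variables (d N : nat) (R : comNzRingType) (x q : fps R).
Hypothesis x0 : coefs x 0 = 0.

Definition descent_at (tau : 'S_d) (k : 'I_d.+1) : bool :=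
  if unlift ord_max k is Some j then j \in Des tau else false.

Lemma descent_at_widen tau (k : 'I_d) :
  descent_at tau (widen_ord (leqnSn d) k) = (k \in Des tau).
Proof.
rewrite /descent_at; case: unliftP => [j|] /(congr1 val) /=.
  by rewrite /bump leqNgt ltn_ord => /val_inj ->.
by have := ltn_ord k; lia.
Qed.

Lemma descent_at_last tau : descent_at tau ord_max = false.
Proof. by rewrite /descent_at unlift_none. Qed.

Lemma des_maj_prod (tau : 'S_d) :
  \prod_(j < d.+1) (x * q ^+ j) ^+ descent_at tau j =
  x ^+ des tau * q ^+ maj tau.
Proof.
rewrite big_ord_recr /= descent_at_last mulr1 /des /maj -sum1_card.
rewrite !expr_sum -big_split [RHS]big_mkcond /=; apply: eq_bigr => k _.
by rewrite descent_at_widen; case: (k \in _); rewrite ?expr1 ?expr0.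
Qed.

(* [l ord0] is the bound on the values and [l (lift ord0 j)] the value of [f]
   at [tau j]. *)
Definition sorted_values (tau : 'S_d) (l : {ffun 'I_d.+1 -> 'I_N.+1}) :
    'I_N.+1 * {ffun 'I_d -> 'I_N.+1} :=
  (l ord0, [ffun i => l (lift ord0 (tau^-1%g i))]).

Lemma sorted_values_bij tau : bijective (sorted_values tau).
Proof.
exists (fun nf : 'I_N.+1 * {ffun 'I_d -> 'I_N.+1} =>
  [ffun k => if unlift ord0 k is Some j then nf.2 (tau j)
                             else nf.1]).
  move=> l; apply/ffunP => k; rewrite ffunE /=.
  by case: unliftP => [j|] -> //; rewrite ffunE permK.
move=> [n f]; congr (_, _); first by rewrite ffunE unlift_none.
by apply/ffunP => i; rewrite !ffunE liftK permKV.
Qed.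

(** The tie-breaking term of [precedes] between tau(k-1) and tau(k) is 1 exactly at a descent, so
    being sorted by [tau] means strictness at its descents. Step 0, never a descent, bounds the
    largest value by n. *)
Lemma sorted_values_chain tau l :
  [forall i, ((sorted_values tau l).2 i <= (sorted_values tau l).1)%N] &&
  sorted_by tau (sorted_values tau l).2 =
  chain l && [forall k : 'I_d, (l (lift ord0 k) + descent_at tau
     (widen_ord (leqnSn d) k) <= l (widen_ord (leqnSn d) k))%N].
Proof.
have stepE (k : 'I_d) (k_gt0 : (0 < k)%N) :
    precedes (sorted_values tau l).2 (tau (ord_pred k)) (tau k) =
    (l (lift ord0 k) + descent_at tau (widen_ord (leqnSn d) k) <=
     l (widen_ord (leqnSn d) k))%N.
  rewrite /precedes /= !ffunE !permK descent_at_widen inE k_gt0 /=.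
  congr (_ <= l _)%N; apply: val_inj.
  rewrite /= -[X in (X + d)%N](prednK k_gt0) addSn /= modnDr modn_small.
    by rewrite /bump /= add1n prednK.
  by rewrite (leq_ltn_trans (leq_pred _)).
apply/andP/andP => -[].
  move=> /forallP le_f /forallP sf.
  have steps (k : 'I_d) : (l (lift ord0 k) + descent_at tau
      (widen_ord (leqnSn d) k) <= l (widen_ord (leqnSn d) k))%N.
    have [k0|k_gt0] := posnP k; last first.
      by rewrite -stepE //; apply: (implyP (sf k)).
    have -> : widen_ord (leqnSn d) k = ord0 by apply: val_inj.
    have := le_f (tau k); rewrite ffunE permK.
    have := descent_at_widen tau k; rewrite inE k0 /=.
    have -> : widen_ord (leqnSn d) k = ord0 by apply: val_inj.
    by move=> ->; rewrite addn0.
  split; last exact/forallP.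
  by apply/forallP => k; apply: leq_trans (steps k); apply: leq_addr.
move=> /forallP ch /forallP steps; split; last first.
  by apply/forallP => k; apply/implyP => k_gt0; rewrite stepE.
(* The bound on all values comes from climbing the chain to its first entry. *)
have le_l0 (k : 'I_d.+1) : (l k <= l ord0)%N.
  have [n] := ubnP k; elim: n k => // n IHn k.
  case: (unliftP ord0 k) => [j ->|-> //]; rewrite ltnS => le_kn.
  by apply: leq_trans (ch j) _; apply: IHn.
by apply/forallP => i; rewrite ffunE.
Qed.

Lemma fps_trunc_sum_sorted tau :
  fps_trunc N ((\sum_(nf : 'I_N.+1 * {ffun 'I_d -> 'I_N.+1} |
     [forall i, (nf.2 i <= nf.1)%N] && sorted_by tau nf.2)
       x ^+ nf.1 * q ^+ (\sum_i nf.2 i)) *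
    \prod_(j < d.+1) (1 - x * q ^+ j)) =
  fps_trunc N (x ^+ des tau * q ^+ maj tau).
Proof.
rewrite (reindex (sorted_values tau)); last exact/onW_bij/sorted_values_bij.
rewrite (eq_bigl _ _ (sorted_values_chain tau)) big_mkcondr /=.
(* A difference that violates strictness at a descent gets weight 0, so the strictness conditions
   are absorbed into the factors. *)
pose t (j : 'I_d.+1) v := if (descent_at tau j <= v)%N then (q ^+ j) ^+ v else 0.
have := @fps_trunc_sum_chain d N R x t _ x0 => /(_ _ _)/fps_truncM.
move/(_ _ _ _ _ erefl) => ->; last first.
  move=> l u lE; rewrite big_split /= -expr_sum.
  have l0E : l ord0 = (\sum_j u j)%N :> nat by rewrite lE.
  have lw (k : 'I_d) : l (widen_ord (leqnSn d) k) =
      (u (widen_ord (leqnSn d) k) + l (lift ord0 k))%N :> nat.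
    by rewrite !lE suffix_sum_rec.
  case: ifPn => [/forallP steps|/forallPn[k]]; last first.
    rewrite lw [leqRHS]addnC leq_add2l => /negbTE not_step.
    by rewrite [X in _ * X](bigD1 (widen_ord (leqnSn d) k)) //= /t not_step
               mul0r mulr0.
  rewrite l0E; congr (_ * _).
  (* Difference j is part of the first j values in sorted order, hence the exponent j. *)
  transitivity (\prod_(j < d.+1) (q ^+ j) ^+ u j).
    under [RHS]eq_bigr do rewrite -exprM.
    rewrite -expr_sum; congr (q ^+ _); under eq_bigr do rewrite ffunE.
    rewrite (reindex_inj (@perm_inj _ tau)) /=.
    by under eq_bigr do rewrite permK lE; rewrite sum_suffix_sums.
  apply: eq_bigr => j _; rewrite /t; case: (unliftP ord_max j) => [k|] jE.
    have -> : j = widen_ord (leqnSn d) k.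
      by apply: val_inj; rewrite jE /= /bump leqNgt ltn_ord.
    by have := steps k; rewrite lw [leqRHS]addnC leq_add2l => ->.
  by rewrite jE descent_at_last.
rewrite -big_split -des_maj_prod; apply: fps_trunc_prod => j _ /=.
(* The sum for j starts at 1 at a descent and at 0 elsewhere, so multiplying by 1 - x q^j leaves x
   q^j or 1. *)
rewrite -fps_trunc_geometric; last by rewrite coefs0M x0 mul0r.
rewrite [in RHS]big_mkcond; congr (fps_trunc _ (_ * _)); apply: eq_bigr => v _.
by rewrite /t; case: ifP; rewrite ?mulr0 // exprMn.
Qed.

Lemma macmahon_carlitz :
  fps_trunc N ((\sum_(n < N.+1) x ^+ n * (\sum_(g < n.+1) q ^+ g) ^+ d) *
    \prod_(j < d.+1) (1 - x * q ^+ j)) =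
  fps_trunc N (euler_mahonian d x q).
Proof.
have -> : \sum_(n < N.+1) x ^+ n * (\sum_(g < n.+1) q ^+ g) ^+ d =
  \sum_tau \sum_(nf : 'I_N.+1 * {ffun 'I_d -> 'I_N.+1} |
     [forall i, (nf.2 i <= nf.1)%N] && sorted_by tau nf.2)
       x ^+ nf.1 * q ^+ (\sum_i nf.2 i).
  (* The d-th power enumerates the functions with values at most n. They share the codomain
     ['I_N.+1] for all n, which lets the sums over n and tau be exchanged. *)
  transitivity (\sum_(n < N.+1) \sum_(f : {ffun 'I_d -> 'I_N.+1} |
      [forall i, (f i <= n)%N]) x ^+ n * q ^+ (\sum_i f i)).
    apply: eq_bigr => n _; rewrite -mulr_sumr; congr (_ * _).
    rewrite -[in LHS](card_ord d) -prodr_const.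
    under eq_bigr do rewrite (big_ord_widen N.+1 (fun g => q ^+ g)) //.
    rewrite bigA_distr_big; apply: eq_big => [f|f _]; last by rewrite expr_sum.
    by apply/ffun_onP/forallP => fn i; have := fn i.
  under eq_bigr do rewrite sum_sorted_by.
  by rewrite exchange_big; apply: eq_bigr => tau _; rewrite pair_big_dep.
rewrite mulr_suml; apply: fps_trunc_sum => tau _; exact: fps_trunc_sum_sorted.
Qed.

End MacMahonCarlitz.

(** * Coefficients of monomials in a and b *)

Lemma coefs_sum (R : comNzRingType) (I : Type) (r : seq I) (P : pred I)
    (F : I -> fps R) n :
  coefs (\sum_(i <- r | P i) F i) n = \sum_(i <- r | P i) coefs (F i) n.
Proof. exact: (big_morph (fun p : fps R => coefs p n)). Qed.

Lemma coefs_fpsCM (R : comNzRingType) (c : R) p n :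
  coefs (fpsC c * p) n = c * coefs p n.
Proof.
by rewrite [LHS]big_ord_recl /= subn0 big1 ?addr0 // => i _; rewrite mul0r.
Qed.

Lemma fpsCX (R : comNzRingType) (c : R) n : fpsC c ^+ n = fpsC (c ^+ n).
Proof.
elim: n => [//|n IHn]; rewrite !exprS IHn; apply: fpsP => i.
by rewrite coefs_fpsCM /=; case: eqP; rewrite ?mulr0.
Qed.

Lemma coefs_fpsXn (R : comNzRingType) n i :
  coefs (fpsX R ^+ n) i = (i == n)%:R.
Proof.
elim: n i => [|n IHn] i; first by rewrite expr0 /=; case: eqP.
rewrite exprS [LHS]/=; case: i => [|i]; first by rewrite big_ord1 /= mul0r.
rewrite big_ord_recl mul0r add0r big_ord_recl /= mul1r subSS subn0 IHn.
by rewrite big1 ?addr0 // => j _; rewrite mul0r.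
Qed.

Lemma coefs_monomial i j m n :
  coefs (coefs (fps_a ^+ i * fps_b ^+ j) n) m = ((m == i) && (n == j))%:R.
Proof.
rewrite fpsCX coefs_fpsCM coefs_fpsXn -mulnb natrM -(coefs_fpsXn int).
by case: eqP; rewrite ?mulr1 ?mulr0.
Qed.

Lemma sum_expr_between (R : pzSemiRingType) (x : R) N lo hi :
  (lo <= hi)%N -> (hi <= N)%N ->
  \sum_(v < N.+1 | (lo <= v <= hi)%N) x ^+ v =
  x ^+ lo * \sum_(g < (hi - lo).+1) x ^+ g.
Proof.
move=> le_lohi le_hiN.
transitivity (\sum_(lo <= v < hi.+1) x ^+ v).
  by rewrite big_geq_mkord (big_ord_widen_cond N.+1 (leq lo) (fun v => x ^+ v)).
rewrite -{1}[lo]add0n big_addn subSn // big_mkord mulr_sumr.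
by apply: eq_bigr => g _; rewrite addnC exprD.
Qed.

(** * Diamonds as finite data modulo b^(N+1) *)

Section BoundedDiamonds.
Variables (M N : nat) (d : 'I_M -> nat).
Implicit Types l : {ffun 'I_M.+1 -> 'I_N.+1}.
Implicit Types f : {ffun {k : 'I_M & 'I_(d k)} -> 'I_N.+1}.

Definition bounded_diamond l f :=
  [forall t, (l (lift ord0 (tag t)) <= f t
              <= l (widen_ord (leqnSn M) (tag t)))%N].

Definition links_folds_of
    (p : {ffun 'I_M.+1 -> 'I_N.+1} * {ffun {k : 'I_M & 'I_(d k)} -> 'I_N.+1}) :
    links_folds d :=
  ([ffun k => p.1 k : nat], [ffun t => p.2 t : nat]).

Lemma links_folds_of_inj : injective links_folds_of.
Proof.
move=> [l f] [l' f'] [/ffunP El /ffunP Ef].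
congr (_, _); apply/ffunP => i; apply: val_inj.
  by have := El i; rewrite !ffunE.
by have := Ef i; rewrite !ffunE.
Qed.

Lemma links_folds_ofP p :
  reflect (is_diamond (links_folds_of p)) (bounded_diamond p.1 p.2).
Proof.
have i1 (k : 'I_M) : inord k.+1 = lift ord0 k :> 'I_M.+1.
  by apply: val_inj; rewrite /= inordK ?ltnS.
have i0 (k : 'I_M) : inord k = widen_ord (leqnSn M) k :> 'I_M.+1.
  by apply: val_inj; rewrite /= inordK // ltnS ltnW.
apply: (iffP forallP) => [dia k i|dia [k i]].
  by have := dia (Tagged _ i); rewrite i0 i1 !ffunE.
by have := dia k i; rewrite i0 i1 !ffunE.
Qed.

Lemma sum_folds_of p :
  sum_folds (links_folds_of p) = (\sum_t p.2 t)%N.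
Proof.
rewrite /sum_folds sig_big_dep /=; apply: eq_bigr => -[k i] _.
by rewrite ffunE.
Qed.

Lemma sum_links_of p : sum_links (links_folds_of p) = (\sum_k p.1 k)%N.
Proof. by apply: eq_bigr => k _; rewrite ffunE. Qed.

(** The links add up to n, so each is at most N, and every fold is at most a link. *)
Lemma diamonds_bounded m n D : (n <= N)%N -> @diamonds M d m n D ->
  exists p, links_folds_of p = D.
Proof.
case: D => l f le_nN [dia [_ En]].
have l_le k : (l k <= N)%N.
  by apply: leq_trans le_nN; rewrite -En /sum_links (bigD1 k) //= leq_addr.
have f_le t : (f t <= N)%N.
  by case: t => k i; have /andP[_ /leq_trans] := dia k i; apply; apply: l_le.
exists ([ffun k => inord (l k)], [ffun t => inord (f t)]).
by congr (_, _); apply/ffunP => i; rewrite !ffunE inordK ?ltnS.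
Qed.

Lemma card_diamonds m n : (n <= N)%N ->
  #|` fset_set (@diamonds M d m n)| =
  #|[pred p | [&& bounded_diamond p.1 p.2, m == (\sum_t p.2 t)%N
                & n == (\sum_k p.1 k)%N]]|.
Proof.
move=> le_nN; set P := [pred p | _].
have -> : fset_set (@diamonds M d m n) =
    [fset links_folds_of p | p in P]%fset.
  apply/fsetP => D; rewrite in_fset_set; last exact: finite_diamonds.
  apply/idP/imfsetP => [/set_mem dD|[p /=]].
    have [p pD] := diamonds_bounded le_nN dD; exists p => //=.
    move: dD; rewrite -pD => -[dia []]; rewrite sum_folds_of sum_links_of.
    by rewrite !inE /= => -> ->; rewrite !eqxx !andbT; apply/links_folds_ofP.
  rewrite !inE => /and3P[/links_folds_ofP dia /eqP Em /eqP En] ->.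
  by split=> //; rewrite sum_folds_of sum_links_of -Em -En.
rewrite card_imfset; last exact: links_folds_of_inj.
by rewrite /= -cardE.
Qed.

Lemma fps_trunc_sigma :
  fps_trunc N (sigma d) =
  fps_trunc N (\sum_(p | bounded_diamond p.1 p.2)
                 fps_a ^+ (\sum_t p.2 t) * fps_b ^+ (\sum_k p.1 k)).
Proof.
apply/fps_truncP => n le_nN; apply: fpsP => m; rewrite coefs_sum coefs_sum /=.
rewrite card_diamonds // -natz -sum1_card natr_sum big_mkcond [RHS]big_mkcond.
apply: eq_bigr => p _; rewrite coefs_monomial inE /=.
by case: (bounded_diamond _ _) => //=; case: (_ && _).
Qed.

Hypothesis d_gt0 : forall k, (0 < d k)%N.

(** Since d_k > 0, some fold lies between any two consecutive links and orders them. *)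
Lemma bounded_diamond_chain l f : bounded_diamond l f -> chain l.
Proof.
move=> /forallP dia; apply/forallP => k.
by have /andP[/leq_trans le1 /le1] := dia (Tagged _ (Ordinal (d_gt0 k))).
Qed.

(** Once the links are fixed, the folds vary independently, each over the interval between the two
    links of its diamond. *)
Lemma sum_bounded_diamond :
  \sum_(p | bounded_diamond p.1 p.2)
     fps_a ^+ (\sum_t p.2 t) * fps_b ^+ (\sum_k p.1 k) =
  \sum_(l : {ffun 'I_M.+1 -> 'I_N.+1} | chain l)
    fps_b ^+ (\sum_k l k) * \prod_(k < M)
      (fps_a ^+ l (lift ord0 k) *
       \sum_(g < (l (widen_ord (leqnSn M) k) - l (lift ord0 k)).+1)
          fps_a ^+ g) ^+ d k.
Proof.
transitivity (\sum_(l : {ffun 'I_M.+1 -> 'I_N.+1} | chain l)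
  \sum_(f | bounded_diamond l f) fps_b ^+ (\sum_k l k) * fps_a ^+ (\sum_t f t)).
  rewrite pair_big_dep /=; apply: eq_big => [[l f]|[l f] _] /=; last by rewrite mulrC.
  case: (boolP (bounded_diamond l f)) => [/bounded_diamond_chain -> //|].
  by rewrite andbF.
apply: eq_bigr => l /forallP ch; rewrite -mulr_sumr; congr (_ * _).
pose F (k : 'I_M) : fps (fps int) := \sum_(v < N.+1 |
  (l (lift ord0 k) <= v <= l (widen_ord (leqnSn M) k))%N) fps_a ^+ v.
transitivity (\prod_(t : {k : 'I_M & 'I_(d k)}) F (tag t)).
  rewrite bigA_distr_big_dep; apply: eq_bigr => f _.
  by rewrite expr_sum.
rewrite -(sig_big_dep (op := *%R) xpredT (fun _ => xpredT) (fun k _ => F k)) /=.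
apply: eq_bigr => k _; rewrite prodr_const card_ord; congr (_ ^+ _).
by apply: sum_expr_between; [apply: ch | rewrite -ltnS].
Qed.

End BoundedDiamonds.

(** * The generating function as a product over link differences *)

Section SigmaProduct.
Variables (M N : nat) (d : 'I_M -> nat).
Hypothesis d_gt0 : forall k, (0 < d k)%N.

(** Adding one to difference j raises the links 0 to j and shifts the range of exactly these folds;
    this is the exponent of a. *)
Definition folds_before (j : nat) : nat := (\sum_(k < M | (k < j)%N) d k)%N.

Lemma fps_trunc_sigma_prod :
  fps_trunc N (sigma d) =
  fps_trunc N
    ((\prod_(k < M) \sum_(n < N.+1)
        (fps_a ^+ folds_before k * fps_b ^+ k.+1) ^+ n *
        (\sum_(g < n.+1) fps_a ^+ g) ^+ d k) *
     \sum_(n < N.+1) (fps_a ^+ folds_before M * fps_b ^+ M.+1) ^+ n).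
Proof.
rewrite fps_trunc_sigma sum_bounded_diamond //.
(* One factor b per unit of difference plays the part of [x] in [fps_trunc_sum_chain], so j remains
   of the j + 1 links raised. The last difference bounds no diamond from above, hence the factor
   1. *)
pose t (j : 'I_M.+1) v : fps (fps int) :=
  (fps_a ^+ folds_before j * fps_b ^+ j) ^+ v *
  (if unlift ord_max j is Some k then (\sum_(g < v.+1) fps_a ^+ g) ^+ d k else 1).
rewrite (@fps_trunc_sum_chain M N _ fps_b t) //; last first.
  move=> l u lE.
  have lw (k : 'I_M) : l (widen_ord (leqnSn M) k) =
      (u (widen_ord (leqnSn M) k) + l (lift ord0 k))%N :> nat.
    by rewrite !lE suffix_sum_rec.
  (* Link 0 contains every difference once; the other links contain difference j in all j times. *)
  have sum_lE : (\sum_k l k)%N = (\sum_j u j + \sum_(j < M.+1) j * u j)%N.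
    rewrite [LHS]big_ord_recl lE; congr (_ + _)%N.
    by under eq_bigr do rewrite lE; rewrite sum_suffix_sums.
  rewrite /t big_split big_split /= sum_lE exprD -expr_sum -!mulrA; congr (_ * _).
  under [X in _ = X * _]eq_bigr do rewrite exprMn -!exprM.
  rewrite big_split /= -!expr_sum [X in _ = X * _]mulrC -mulrA.
  congr (fps_b ^+ _ * _); under eq_bigr do rewrite exprMn -exprM.
  rewrite big_split /= -expr_sum; congr (fps_a ^+ _ * _).
    rewrite -sum_weighted_suffix_sums.
    by apply: eq_bigr => k _; rewrite lE mulnC.
  rewrite big_ord_recr /= unlift_none mulr1; apply: eq_bigr => k _.
  rewrite lw addnK; case: unliftP => [j|] /(congr1 val) /=.
    by rewrite /bump leqNgt ltn_ord => /val_inj <-.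
  by have := ltn_ord k; lia.
congr (fps_trunc N _); rewrite big_ord_recr /=; congr (_ * _).
  apply: eq_bigr => k _; apply: eq_bigr => v _; rewrite /t.
  case: unliftP => [j|] /(congr1 val) /=; last by have := ltn_ord k; lia.
  rewrite /bump leqNgt ltn_ord => /val_inj <-.
  by rewrite mulrA -exprMn mulrCA exprS.
apply: eq_bigr => v _; rewrite /t unlift_none mulr1 -exprMn mulrCA.
by rewrite exprS.
Qed.

End SigmaProduct.

(** * The product formula *)

Lemma coefs_monomial0 i j : (0 < j)%N -> coefs (fps_a ^+ i * fps_b ^+ j) 0 = 0.
Proof.
by case: j => // j _; apply: fpsP => m; rewrite coefs_monomial andbF.
Qed.

Theorem theorem3p1 (M : nat) (d : 'I_M -> nat)
    (hM : (0 < M)%N) (hd : forall k : 'I_M, (0 < d k)%N) :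
  sigma (fun k : 'I_M => d (rev_ord k)) =
  (\prod_(k < M)
     euler_mahonian (d k) (fps_a ^+ omega d k.+1 * fps_b ^+ (M - k)) fps_a) /
  ((1 - fps_a ^+ omega d 0 * fps_b ^+ M.+1) *
   \prod_(k < M) \prod_(j < (d k).+1)
     (1 - fps_a ^+ (omega d k.+1 + d k - j) * fps_b ^+ (M - k))).
Proof.
(* The denominator is a unit, so it moves to the left, and the identity is checked modulo every
   b^(N+1). *)
apply: (canRL (mulrK (denominator_unit d))); apply: eq_fps_trunc => N.
(* Reversal turns the folds of earlier diamonds into those of larger index, which [omega] counts. *)
have folds_before_rev (k : 'I_M) :
    folds_before (fun k => d (rev_ord k)) (rev_ord k) = omega d k.+1.
  rewrite /folds_before (reindex_inj rev_ord_inj) /=.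
  apply: eq_big => [j|j _]; last by rewrite rev_ordK.
  by have := ltn_ord j; have := ltn_ord k; lia.
have folds_before_all : folds_before (fun k => d (rev_ord k)) M = omega d 0.
  rewrite /folds_before (reindex_inj rev_ord_inj) /=.
  apply: eq_big => [j|j _]; last by rewrite rev_ordK.
  by have := ltn_ord j; lia.
rewrite (fps_truncM (fps_trunc_sigma_prod N _) erefl); last by move=> k.
(* Regrouping pairs the geometric series of the last difference with 1 - a^(omega_0) b^(M+1), and
   the sums of the diamonds with the double product. *)
rewrite folds_before_all [X in _ * X]mulrC mulrACA -[in RHS](mulr1 (\prod_k _)).
apply: fps_truncM; last first.
  by rewrite -[1 in RHS](expr0 (fps_a ^+ omega d 0 * fps_b ^+ M.+1))
             -fps_trunc_geometric ?coefs_monomial0.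
rewrite (reindex_inj rev_ord_inj) -big_split; apply: fps_trunc_prod => k _ /=.
rewrite folds_before_rev rev_ordK subnSK // -macmahon_carlitz; last first.
  by rewrite coefs_monomial0 // subn_gt0.
(* The statement lists these factors by decreasing powers of a, so j is exchanged with d_k - j. *)
congr (fps_trunc N (_ * _)); rewrite (reindex_inj rev_ord_inj) /=.
apply: eq_bigr => j _; rewrite subSS -addnBA ?leq_subr // subKn -1?ltnS //.
by rewrite exprD mulrAC.
Qed.
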